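(* Let $n\ge 0$. The map $e$ restricts to a bijection from the set of even-special Dyck paths of length $n$ with no special steps to the set of little Schröder paths of length $n$ with no horizontal steps. Moreover, for all integers $j\ge 1$ and $k\ge 0$, $e$ restricts to a bijection from the set of little hybrid paths of length $n$ with exactly $j$ special steps and exactly $k$ horizontal steps to the set of little hybrid paths of length $n$ with exactly $j-1$ special steps and exactly $k+1$ horizontal steps.
   Context: **Paths.** All lattice paths of length $n$ start at $(0,0)$, end at $(n,0)$, never go below the $x$-axis, and consist of upsteps U $=(1,1)$, downsteps $(1,-1)$, and double horizontal steps HH $=(2,0)$. A double horizontal step is treated as one indivisible ''horizontal step'' and contributes $2$ to the length. Each downstep is either ordinary (written D) or carries the label ''special'' (written d); paths with different labels are different. A Dyck path has no horizontal steps. A little Schröder path is a path of upsteps, ordinary downsteps and horizontal steps (no special steps) with no horizontal step at height $0$. An even-special Dyck path is a Dyck path in which an arbitrary subset of the downsteps that leave from even height (i.e. whose starting height is even) are labeled special. **Matching upstep.** The upstep matching a downstep $d$ is the rightmost upstep to the left of $d$ that ends at the height from which $d$ leaves. **The map $e$.** If a path has no special steps, $e$ leaves it unchanged. Otherwise take the leftmost special step $s$. (Flatten) If $s$ is immediately preceded by an upstep, replace that upstep and $s$ by one horizontal step HH. (Slide) If $s$ is immediately preceded by a downstep $d$ (necessarily ordinary), let $u$ be the upstep matching $d$ and let $P$ be the (possibly empty) subpath strictly between $u$ and $d$; replace the portion $u\,P\,d\,s$ of the path by HH $P$ D, i.e. replace $u$ with a horizontal step, delete $d$, let $P$ follow the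 horizontal step, and make $s$ an ordinary downstep. For the paths below these are the only cases that occur. **Little hybrid paths.** The set of little hybrid paths is the smallest set of paths that contains all even-special Dyck paths and is closed under $e$. *)

(* Defs.v *)
From HB Require Import structures.
From mathcomp Require Import all_boot all_order all_algebra.

Set Implicit Arguments.
Unset Strict Implicit.
Unset Printing Implicit Defensive.

(* [D] is an ordinary downstep, [Dspec] a special one; [HH] is the indivisible
   horizontal step (2, 0). *)
Inductive step := U | D | Dspec | HH.

Definition step_code (s : step) : bool * bool :=
  match s with
  | U => (true, true) | D => (false, true)
  | Dspec => (false, false) | HH => (true, false)
  end.

Definition step_decode (c : bool * bool) : step :=
  match c with
  | (true, true) => U | (false, true) => D
  | (false, false) => Dspec | (true, false) => HH
  end.

Lemma step_codeK : cancel step_code step_decode.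
Proof. by case. Qed.

HB.instance Definition _ := Finite.copy step (can_type step_codeK).

Definition is_downstep (s : step) : bool := (s == D) || (s == Dspec).

Definition path_length (p : seq step) : nat :=
  sumn [seq (if s == HH then 2 else 1) | s <- p].

Definition height (p : seq step) : int :=
  ((count_mem U p)%:Z - (count is_downstep p)%:Z)%R.

Definition lattice_path (p : seq step) : Prop :=
  height p = 0%R /\ forall q r, p = q ++ r -> (0 <= height q)%R.

Definition num_special (p : seq step) : nat := count_mem Dspec p.
Definition num_horizontal (p : seq step) : nat := count_mem HH p.

Definition even_special_dyck (p : seq step) : Prop :=
  [/\ lattice_path p,
      HH \notin p
    & forall q r, p = q ++ Dspec :: r -> (2 %| height q)%Z].

Definition little_schroder (p : seq step) : Prop :=
  [/\ lattice_path p,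
      Dspec \notin p
    & forall q r, p = q ++ HH :: r -> height q <> 0%R].

(* Steps are numbered from 0, so step [i] of [p] leaves from height
   [height (take i p)] and ends at height [height (take i.+1 p)].
   [matching_upstep p m] is the position of the upstep matching the downstep at
   position [m]; the result is [None] if there is no such upstep, which cannot
   happen in a lattice path. *)
Definition matching_upstep (p : seq step) (m : nat) : option nat :=
  ohead (rev [seq i <- iota 0 m |
    (nth U p i == U) && (height (take i.+1 p) == height (take m p))]).

(* The leftmost special step is at position [index Dspec p], which is [size p]
   when [p] has no special step.  In the cases that do not occur for little
   hybrid paths (special step in first position or preceded by a horizontal
   step), [e] conventionally returns [p]. *)
Definition e (p : seq step) : seq step :=
  if Dspec \notin p then p else
  if index Dspec p is m.+1 then
    match nth U p m with
    | U => take m p ++ HH :: drop m.+2 p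
    | D => if matching_upstep p m is Some l then
             take l p ++ HH :: drop l.+1 (take m p) ++ D :: drop m.+2 p
           else p
    | _ => p
    end
  else p.

Inductive little_hybrid : seq step -> Prop :=
| LittleHybridBase p : even_special_dyck p -> little_hybrid p
| LittleHybridStep p : little_hybrid p -> little_hybrid (e p).

(* Main.v *)
(** Call a horizontal step at even height closed if the path later drops below
its level.  Little hybrid paths are exactly the lattice paths with special steps
at even heights, all horizontal steps to the left of all special steps, and
every even horizontal step closed before the first special step.

On such a path [e] is invertible.  Flattening creates a horizontal step at odd
height, sliding one at even height.  Given a little hybrid path with a
horizontal step, consider the even horizontal steps that are still open just
after the last horizontal step: if there is one, the leftmost was created by the
last slide, which is undone by [HH q D -> U q D d], the exhibited [D] being the
first step to go below its level; otherwise the last horizontal step lies at odd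
height and comes from a flattening, undone by [HH -> U d]. *)

Require Import Defs.
From mathcomp Require Import all_boot all_order all_algebra.
From mathcomp Require Import boolp classical_sets functions.
From mathcomp Require Import zify.
Local Open Scope classical_set_scope.

Section Paths.
Set Implicit Arguments.
Unset Strict Implicit.
Import Order.TTheory GRing.Theory Num.Theory.
Local Open Scope ring_scope.
Implicit Types (p q r : seq step) (h k : int).

(** * Decidable path conditions, relative to a starting height *)

Fixpoint nonneg_from h p : bool :=
  (0 <= h) && if p is x :: p' then nonneg_from (h + height [:: x]) p' else true.

Fixpoint specials_even h p : bool :=
  if p is x :: p' then
    ((x == Dspec) ==> (2 %| h)%Z) && specials_even (h + height [:: x]) p'
  else true.

(* [r] is the continuation of the path after [p]: it may close horizontal steps
   of [p], but its own horizontal steps are not examined. *)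
Fixpoint closed_in h p r : bool :=
  if p is x :: p' then
    ((x == HH) && (2 %| h)%Z ==> ~~ nonneg_from 0 (p' ++ r))
    && closed_in (h + height [:: x]) p' r
  else true.

Lemma height_nil : height [::] = 0. Proof. by []. Qed.

Lemma height_cat p q : height (p ++ q) = height p + height q.
Proof. by rewrite /height !count_cat; lia. Qed.

Lemma height_cons x p : height (x :: p) = height [:: x] + height p.
Proof. by rewrite -cat1s height_cat. Qed.

Lemma add_height_cons h x p :
  h + height (x :: p) = h + height [:: x] + height p.
Proof. by rewrite (height_cons x p) addrA. Qed.

Lemma height_step x :
  height [:: x] = match x with U => 1 | HH => 0 | _ => -1 end.
Proof. by case: x. Qed.

Definition heightE := (height_nil, height_step, height_cat, height_cons).

Lemma nonneg_from_ge0 h p : nonneg_from h p -> 0 <= h.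
Proof. by case: p => [|x p] /= /andP[]. Qed.

Lemma nonneg_from_cat h p q :
  nonneg_from h (p ++ q) = nonneg_from h p && nonneg_from (h + height p) q.
Proof.
elim: p h => [|x p IH] h /=.
  rewrite height_nil addr0 andbT; apply/idP/andP => [hq|[]//].
  by split=> //; apply: nonneg_from_ge0 hq.
by rewrite IH -add_height_cons andbA.
Qed.

Lemma nonneg_from_le h k p : h <= k -> nonneg_from h p -> nonneg_from k p.
Proof.
elim: p h k => [|x p IH] h k hk /= /andP[h0 hp]; first by rewrite (le_trans h0).
by rewrite (le_trans h0) //=; apply: IH hp; rewrite lerD2r.
Qed.

Lemma nonneg_from_last h p : nonneg_from h p -> 0 <= h + height p.
Proof. by rewrite -{1}[p]cats0 nonneg_from_cat => /andP[_] /nonneg_from_ge0. Qed.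

Lemma nonneg_fromP h p :
  reflect (forall q r, p = q ++ r -> 0 <= h + height q) (nonneg_from h p).
Proof.
apply: (iffP idP) => [hp q r pE|hp].
  by move: hp; rewrite pE nonneg_from_cat => /andP[/nonneg_from_last].
elim: p h hp => [|x p IH] h hp /=.
  by have := hp [::] [::] erefl; rewrite height_nil addr0 => ->.
have := hp [::] _ erefl; rewrite height_nil addr0 => -> /=.
by apply: IH => q r pE; rewrite -add_height_cons; apply: (hp _ r); rewrite pE.
Qed.

Lemma specials_even_cat h p q : specials_even h (p ++ q) =
  specials_even h p && specials_even (h + height p) q.
Proof.
elim: p h => [|x p IH] h /=; first by rewrite height_nil addr0.
by rewrite IH -add_height_cons andbA.
Qed.

Lemma specials_evenP h p :
  reflect (forall q r, p = q ++ Dspec :: r -> (2 %| h + height q)%Z)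
          (specials_even h p).
Proof.
apply: (iffP idP) => [hp q r pE|hp].
  by move: hp; rewrite pE specials_even_cat /= => /and3P[].
elim: p h hp => [|x p IH] h hp //=; apply/andP; split.
  apply/implyP => /eqP xE; have := hp [::] p; rewrite height_nil addr0 xE.
  exact.
by apply: IH => q r pE; rewrite -add_height_cons; apply: (hp _ r); rewrite pE.
Qed.

Lemma specials_even_notin h p : Dspec \notin p -> specials_even h p.
Proof.
elim: p h => [|x p IH] h //=.
by rewrite in_cons negb_or eq_sym => /andP[/negbTE-> pN]; apply: IH.
Qed.

Lemma closed_in_cat h p q r : closed_in h (p ++ q) r =
  closed_in h p (q ++ r) && closed_in (h + height p) q r.
Proof.
elim: p h => [|x p IH] h /=; first by rewrite height_nil addr0.
by rewrite IH -add_height_cons andbA catA.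
Qed.

(** The tail matters only through the levels from which it goes below 0. This is what allows a
    continuation that never descends to be dropped. *)
Lemma closed_in_mono h p r r' :
    (forall c, nonneg_from c r' -> nonneg_from c r) ->
  closed_in h p r -> closed_in h p r'.
Proof.
move=> rr'; elim: p h => [|x p IH] h //= /andP[hx /IH ->]; rewrite andbT.
case: (_ && _) hx => //=; apply: contra.
by rewrite !nonneg_from_cat => /andP[-> /rr'].
Qed.

Lemma closed_in_notin h p r : HH \notin p -> closed_in h p r.
Proof.
elim: p h => [|x p IH] h //=.
by rewrite in_cons negb_or eq_sym => /andP[/negbTE-> pN]; apply: IH.
Qed.

(** The end of [p ++ r] lies strictly below every height visited by [p], so it closes every
    horizontal step of [p], whatever its parity. *)
Lemma closed_in_below h k p r :
  nonneg_from k p -> k + height (p ++ r) < 0 -> closed_in h p r.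
Proof.
elim: p h k => [|x p IH] h k //= /andP[k0 kp].
rewrite add_height_cons => kpr; rewrite (IH _ _ kp kpr) andbT.
apply/implyP => /andP[/eqP xE _]; apply/negP => /nonneg_from_last.
by move: kpr; rewrite xE !heightE; lia.
Qed.

Lemma closed_in_first_open h p r : ~~ closed_in h p r ->
  exists p1 p2, [/\ p = p1 ++ HH :: p2, (2 %| h + height p1)%Z,
                    nonneg_from 0 (p2 ++ r) & closed_in h p1 (HH :: p2 ++ r)].
Proof.
elim: p h => [|x p IH] h //=.
case: (boolP (_ ==> _)) => [hx /IH [p1 [p2 [pE ev op cl]]]|].
  exists (x :: p1), p2; split => //=; first by rewrite pE.
    by rewrite (add_height_cons _ x).
  by rewrite cl andbT; move: hx; rewrite pE -catA.
rewrite negb_imply negbK => /andP[/andP[/eqP -> ev] op] _.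
by exists [::], p; rewrite height_nil addr0.
Qed.

(** * First descents and matching upsteps *)

Lemma first_below h p : 0 <= h -> ~~ nonneg_from h p ->
  exists q x r, [/\ p = q ++ x :: r, is_downstep x, nonneg_from h q &
                    h + height q = 0].
Proof.
elim: p h => [|x p IH] h /= h0; rewrite h0 //=.
have [hx /(IH _ hx)[q [y [r [-> dy nq hq]]]]|] := boolP (0 <= h + height [:: x]).
  exists (x :: q), y, r; split=> //=; first by rewrite h0.
  by rewrite (add_height_cons _ x).
move=> hx _; exists [::], x, p; rewrite /= h0 height_nil.
by move: hx; rewrite height_step; case: x => //; split => //; lia.
Qed.

(** Last-passage decomposition, by strong induction on the length with the last step removed; the
    exhibited [U] is the upstep matching a downstep appended to [p]. *)
Lemma matching_exists p : nonneg_from 0 p -> 0 < height p ->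
  exists q r, [/\ p = q ++ U :: r, nonneg_from 0 r & height r = 0].
Proof.
have [n] := ubnP (size p); elim: n p => // n IH p.
case/lastP: p => [|p x] //; rewrite -cats1 size_cat addn1 ltnS => sp.
rewrite nonneg_from_cat height_cat => /andP[np _] hp.
have [xU|xU] := eqVneq x U; first by exists p, [::]; rewrite xU.
have {}xU : height [:: x] <= 0 by move: xU; case: x hp.
have p0 : 0 < height p by lia.
have [q [r [pE nr hr]]] := IH p sp np p0.
have [x0|x0] := eqVneq (height [:: x]) 0.
  exists q, (r ++ [:: x]); rewrite pE -catA nonneg_from_cat nr height_cat hr x0.
  by split=> //=; rewrite ?hr ?x0.
have {xU} x1 : height [:: x] = -1 by move: x0 xU; case: x {hp}.
(* The final downstep cancels the upstep just found, so the one sought lies further left, in [q]. *)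
have nq : nonneg_from 0 q by move: np; rewrite pE nonneg_from_cat => /andP[].
have hq : 0 < height q by move: hp; rewrite x1 pE !heightE hr; lia.
have sq : (size q < n)%N by move: sp; rewrite pE size_cat /=; lia.
have [q' [r' [qE nr' hr']]] := IH q sq nq hq.
exists q', (r' ++ U :: r ++ [:: x]); split.
- by rewrite pE qE -!catA.
- rewrite nonneg_from_cat nr' hr' /= nonneg_from_cat hr /= x1 height_step.
  by rewrite (nonneg_from_le _ nr).
- by rewrite !height_cat (height_cons U) height_cat hr hr' x1.
Qed.

(** * Explicit values of [e] *)

Lemma e_id p : Dspec \notin p -> e p = p.
Proof. by rewrite /e => ->. Qed.

Lemma index_special p q : Dspec \notin p ->
  index Dspec (p ++ Dspec :: q) = size p.
Proof. by move=> pN; rewrite index_cat (negbTE pN) /= addn0. Qed.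

Lemma e_flatten p q : Dspec \notin p -> e (p ++ U :: Dspec :: q) = p ++ HH :: q.
Proof.
move=> pN; have -> : p ++ U :: Dspec :: q = (p ++ [:: U]) ++ Dspec :: q.
  by rewrite -catA.
rewrite /e mem_cat mem_head orbT /= index_special; last first.
  by rewrite mem_cat negb_or pN.
rewrite size_cat addn1 -catA /= nth_cat ltnn subnn /=.
by rewrite take_size_cat // drop_cat ltnNge leqW //= subSn // subSnn /= drop0.
Qed.

Lemma matching_upstep_cat p q r : nonneg_from 0 q -> height q = 0 ->
  matching_upstep (p ++ U :: q ++ r) (size (p ++ U :: q)) = Some (size p).
Proof.
move=> nq hq; rewrite /matching_upstep size_cat /= iotaD add0n /= filter_cat /=.
have tl : take (size p + (size q).+1) (p ++ U :: q ++ r) = p ++ U :: q.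
  by rewrite takeD take_size_cat // drop_size_cat //= take_size_cat.
rewrite nth_cat ltnn subnn /= tl.
have -> : take (size p).+1 (p ++ U :: q ++ r) = p ++ [:: U].
  by rewrite -addn1 takeD take_size_cat // drop_size_cat //= take0.
rewrite !height_cat (height_cons U q) hq addr0 eqxx.
have -> : [seq i <- iota (size p).+1 (size q) | (nth U (p ++ U :: q ++ r) i == U)
    & height (take i.+1 (p ++ U :: q ++ r)) == height p + height [:: U]] = [::].
  apply/eqP; rewrite -[_ == _]negbK -has_filter; apply/hasPn => i.
  rewrite mem_iota => /andP[pi iq].
  have [j [jq ->]] : exists j, (j < size q)%N /\ i = (size p).+1 + j.
    by exists (i - (size p).+1)%N; lia.
  rewrite nth_cat ifF; last by lia.
  have -> : ((size p).+1 + j - size p = j.+1)%N by lia.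
  have -> : (((size p).+1 + j).+1 = size p + j.+2)%N by lia.
  rewrite takeD take_size_cat // drop_size_cat //= nth_cat jq takel_cat //.
  (* An upstep inside [q] starts at or above the level where [q] starts, hence ends strictly above
     it and is no candidate. *)
  apply/negP => /andP[/eqP jU]; rewrite (take_nth U) // jU -cats1.
  rewrite !heightE => /eqP ht.
  move: nq; rewrite -(cat_take_drop j q) nonneg_from_cat => /andP[/nonneg_from_last].
  by move: ht; lia.
by rewrite rev_cat.
Qed.

Lemma e_slide p q r : Dspec \notin p -> Dspec \notin q ->
    nonneg_from 0 q -> height q = 0 ->
  e (p ++ U :: q ++ D :: Dspec :: r) = p ++ HH :: q ++ D :: r.
Proof.
move=> pN qN nq hq.
have aE s : p ++ U :: q ++ s = (p ++ U :: q) ++ s by rewrite -catA.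
have sE : index Dspec (p ++ U :: q ++ D :: Dspec :: r) = (size (p ++ U :: q)).+1.
  rewrite aE -cat_rcons index_special ?size_rcons //.
  by rewrite mem_rcons in_cons mem_cat in_cons !negb_or pN qN.
have sI : Dspec \in p ++ U :: q ++ D :: Dspec :: r.
  by rewrite -index_mem sE aE !size_cat /= !addnS !ltnS leq_addr.
rewrite /e sI sE /= matching_upstep_cat //.
rewrite aE nth_cat ltnn subnn /= -catA take_size_cat //.
rewrite [p ++ _ ++ _]catA take_size_cat // !drop_cat ltnNge leqnSn.
rewrite subSnn /= drop0 ltnNge -addn2 leq_addr addKn /= drop0 //.
Qed.

(** * Factorizations of words *)

Lemma mem_split_first (T : eqType) (x : T) (s : seq T) : x \in s ->
  exists s1 s2, s = s1 ++ x :: s2 /\ x \notin s1.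
Proof.
elim: s => [|y s IH] //; have [->|yx] := eqVneq y x.
  by exists [::], s.
rewrite inE eq_sym (negbTE yx) => /IH[s1 [s2 [-> xN]]].
by exists (y :: s1), s2; rewrite inE negb_or eq_sym yx.
Qed.

Lemma mem_split_last (T : eqType) (x : T) (s : seq T) : x \in s ->
  exists s1 s2, s = s1 ++ x :: s2 /\ x \notin s2.
Proof.
rewrite -mem_rev => /mem_split_first[s1 [s2 [/(congr1 rev)]]].
rewrite revK rev_cat rev_cons -cats1 -catA => -> xN.
by exists (rev s2), (rev s1); rewrite mem_rev.
Qed.

(** Levi's lemma for free monoids. *)
Lemma cat_eq_cat (T : Type) (a b c d : seq T) : a ++ b = c ++ d ->
  (exists t, c = a ++ t /\ b = t ++ d) \/ (exists t, a = c ++ t /\ d = t ++ b).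
Proof.
elim: a c => [|x a IH] [|y c] /=; first by left; exists [::].
- by move=> ->; left; exists (y :: c).
- by move=> <-; right; exists (x :: a).
- by case=> -> /IH[[t [-> ->]]|[t [-> ->]]]; [left|right]; exists t.
Qed.

(** * Intrinsic description of hybrid paths, and the two moves *)

(** The cut [a ++ b] puts horizontal steps before special ones; the empty tail in [closed_in] forces
    [a] to close its even horizontal steps by itself. *)
Definition hybrid p :=
  [/\ nonneg_from 0 p, height p = 0, specials_even 0 p &
      exists a b, [/\ p = a ++ b, Dspec \notin a, HH \notin b &
                      closed_in 0 a [::]]].

(* [a ++ U :: Dspec :: b] is sent by [e] to [a ++ HH :: b]. *)
Definition flattening (a b : seq step) :=
  [/\ Dspec \notin a, HH \notin b, closed_in 0 a [::] & ~~ (2 %| height a)%Z].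

(* [a ++ U :: q ++ D :: Dspec :: b] is sent by [e] to
   [a ++ HH :: q ++ D :: b]. *)
Definition sliding (a q b : seq step) :=
  [/\ [/\ Dspec \notin a, Dspec \notin q & HH \notin b],
      closed_in 0 a [::], (2 %| height a)%Z, nonneg_from 0 q & height q = 0].

Lemma closed_in_nil h p r : closed_in h p [::] -> closed_in h p r.
Proof. by apply: closed_in_mono => c /nonneg_from_ge0 /= ->. Qed.

(** As [height a] is odd, the special step leaves from even height, and the new horizontal step, at
    odd height, need not be closed. *)
Lemma hybrid_flattening a b : flattening a b ->
  hybrid (a ++ U :: Dspec :: b) <-> hybrid (a ++ HH :: b).
Proof.
move=> [aN bN cl od].
rewrite /hybrid !nonneg_from_cat !specials_even_cat /= !heightE !add0r !addr0.
rewrite addrK !(specials_even_notin _ aN) /=.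
have -> : (2 %| height a + 1)%Z by move: od; lia.
split=> [[/and4P[na h0 _ nb] hb sb _]|[/and3P[na h0 nb] hb sb _]].
  split; [by rewrite na h0 nb|by move: hb; lia|by []|].
  exists (a ++ [:: HH]), b.
  rewrite -catA mem_cat inE negb_or aN closed_in_cat (closed_in_nil _ cl) /=.
  by rewrite add0r (negbTE od).
split; [by rewrite na h0 nb addr_ge0|by move: hb; lia|by []|].
by exists a, (U :: Dspec :: b); rewrite aN cl.
Qed.

(** Both middle portions have total height -1, and the special step leaves from the even height of
    [a]. The exhibited [D] closes the new horizontal step and all those of [q], so the cut goes
    right after it. *)
Lemma hybrid_sliding a q b : sliding a q b ->
  hybrid (a ++ U :: q ++ D :: Dspec :: b) <-> hybrid (a ++ HH :: q ++ D :: b).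
Proof.
move=> [[aN qN bN] cl ev nq hq].
rewrite /hybrid !(nonneg_from_cat, specials_even_cat, =^~ cat_cons) /=.
rewrite !heightE !add0r !addr0 hq !addr0 addrK.
rewrite !(specials_even_notin _ aN) !(specials_even_notin _ qN) /= ev.
split=> [[/and5P[na /andP[h0 _] _ _ nb] hb sb _]|
         [/and4P[na /andP[h0 _] _ nb] hb sb _]].
  split; [by rewrite na h0 nb (nonneg_from_le h0)|by move: hb; lia|by []|].
  exists (a ++ HH :: q ++ [:: D]), b; rewrite -!(catA, cat_cons) bN.
  rewrite !(mem_cat, in_cons) !negb_or aN qN !closed_in_cat closed_in_nil //=.
  rewrite (closed_in_below _ nq) ?heightE ?hq //= andbT.
  by rewrite !nonneg_from_cat /= hq !andbF implybT.
split; [|by move: hb; lia|by []|].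
  have h1 : 0 <= height a + 1 by rewrite addr_ge0.
  by rewrite na h0 nb h1 (nonneg_from_le h1).
exists (a ++ U :: q ++ [:: D]), (Dspec :: b); rewrite -!(catA, cat_cons) bN.
rewrite !(mem_cat, in_cons) !negb_or aN qN !closed_in_cat closed_in_nil //=.
by rewrite (closed_in_below _ nq) ?heightE ?hq.
Qed.

Lemma hybrid_special p : hybrid p -> Dspec \in p ->
  (exists a b, p = a ++ U :: Dspec :: b /\ flattening a b) \/
  (exists a q b, p = a ++ U :: q ++ D :: Dspec :: b /\ sliding a q b).
Proof.
move=> [np _ sp [a [b [pE aN bN cl]]]] pd.
have /mem_split_first[b1 [b2 [bE b1N]]] : Dspec \in b.
  by move: pd; rewrite pE mem_cat (negbTE aN).
move: bN; rewrite bE mem_cat in_cons !negb_or => /and3P[b1H _ b2H].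
(* The cut is moved right to the leftmost special step; [b1] brings no horizontal step. *)
have {}cl : closed_in 0 (a ++ b1) [::].
  rewrite closed_in_cat (closed_in_notin _ _ b1H) andbT.
  by apply: closed_in_mono cl => c; rewrite cats0 => /nonneg_from_ge0 /= ->.
have {aN b1N} aN : Dspec \notin a ++ b1 by rewrite mem_cat negb_or aN.
move: pE; rewrite bE catA.
move: (a ++ b1) aN cl => {bE pd a b b1 b1H} a aN cl pE.
move: np sp; rewrite pE nonneg_from_cat specials_even_cat /=.
rewrite add0r height_step => /and3P[na _ /nonneg_from_ge0 ha] /and3P[_ ev _].
case/lastP: a aN cl na ha ev pE => [|a x]; first by rewrite height_nil.
rewrite -cats1 mem_cat mem_seq1 negb_or height_cat => /andP[aN xN].
rewrite closed_in_cat nonneg_from_cat height_step => /andP[cl clx] /andP[na _].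
case: x xN clx cl => // _; last first.
(* A horizontal step just before the special one would be at even height and still open. *)
- by move=> /= clx _ _; rewrite addr0 => ev; move: clx; rewrite add0r ev.
- move=> _ cl ha ev pE; right.
  have [|c [q [aE nq hq]]] := matching_exists na; first by move: ha; lia.
  exists c, q, b2; split; first by rewrite aE -!(catA, cat_cons).
  move: aN cl ev; rewrite aE mem_cat in_cons closed_in_cat !heightE hq.
  rewrite !negb_or => /and3P[cN _ qN] /andP[cl _] ev.
  split=> //; last by move: ev; lia.
  (* [U :: q ++ [:: D]] never goes below its start, so it closes nothing in [c]. *)
  apply: closed_in_mono cl => k /nonneg_from_ge0 k0.
  have k1 : 0 <= k + 1 by rewrite addr_ge0.
  rewrite /= k0 nonneg_from_cat hq /= !height_step addr0 addrK k1 k0.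
  by rewrite (nonneg_from_le k1).
- move=> _ cl ha ev pE; left.
  exists a, b2; split; first by rewrite -catA.
  split=> //; last by move: ev; lia.
  apply: closed_in_mono cl => k /nonneg_from_ge0 k0.
  by rewrite /= k0 height_step addr_ge0.
Qed.

Lemma hybrid_horizontal p : hybrid p -> HH \in p ->
  (exists a b, p = a ++ HH :: b /\ flattening a b) \/
  (exists a q b, p = a ++ HH :: q ++ D :: b /\ sliding a q b).
Proof.
move=> [np _ _ [a [b [pE aN bN cl]]]] ph.
have /mem_split_last[a1 [a2 [aE a2N]]] : HH \in a.
  by move: ph; rewrite pE mem_cat (negbTE bN) orbF.
move: aN; rewrite aE mem_cat in_cons !negb_or => /and3P[a1N _ a2D].
have pE1 : p = a1 ++ HH :: a2 ++ b by rewrite pE aE -catA.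
have bN1 : HH \notin a2 ++ b by rewrite mem_cat negb_or a2N.
have [|] := boolP (closed_in 0 (a1 ++ [:: HH]) [::]).
  (* With nothing after it, a horizontal step at even height would be open; hence the height is
     odd. *)
  rewrite closed_in_cat /= implybF andbT add0r => /andP[cl1 ev]; left.
  exists a1, (a2 ++ b); split=> //; split=> //.
  apply: closed_in_mono cl1 => k /nonneg_from_ge0 k0.
  by rewrite /= height_step addr0 k0.
move=> /closed_in_first_open[c [q [cE ev op clc]]]; right.
have a1E : a = c ++ HH :: q ++ a2.
  by rewrite aE -cat1s catA cE -catA.
move: ev; rewrite add0r => ev.
(* The step is open up to the last horizontal step but closed within [a], so its closing step lies
   in [a2], where no downstep is special. *)
have cd : ~~ nonneg_from 0 (q ++ a2).
  by move: cl; rewrite a1E closed_in_cat /= add0r ev cats0 => /and3P[].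
have nq : nonneg_from 0 q by rewrite -[q]cats0.
move: cd; rewrite nonneg_from_cat nq /=.
move=> /(first_below (nonneg_from_last nq))[r [x [s [rE xD nr hr]]]].
have {xD} xD : x = D.
  case: x xD rE => // _ rE; move: a2D.
  by rewrite rE mem_cat in_cons eqxx orbT.
exists c, (q ++ r), (s ++ b); split.
  by rewrite pE a1E rE xD -!(catA, cat_cons).
have : Dspec \notin c ++ HH :: q ++ a2.
  by rewrite -a1E aE mem_cat in_cons negb_or a1N.
rewrite rE !(mem_cat, in_cons) !negb_or => /and5P[cN _ qN rN /andP[_ sN]].
move: bN1; rewrite rE !(mem_cat, in_cons) !negb_or -!andbA.
move=> /and4P[_ _ sH bH]; split.
- by rewrite cN !mem_cat !negb_or qN rN sH bH.
- apply: closed_in_mono clc => k /nonneg_from_ge0 k0.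
  by rewrite /= height_step addr0 k0 (nonneg_from_le k0 op).
- by [].
- by rewrite nonneg_from_cat nq.
- by move: hr; rewrite add0r height_cat.
Qed.

(** * Uniqueness of the move that produced a path *)

Lemma cat_cons_notin (T : eqType) (x : T) (a b c d : seq T) : x \notin d ->
  a ++ x :: b = c ++ d -> exists t, c = a ++ x :: t /\ b = t ++ d.
Proof.
move=> dN /cat_eq_cat[[[|y t] [cE dE]]|[t [cE dE]]].
- by move: dN; rewrite -[d]dE mem_head.
- by case: dE => -> ->; exists t.
- by move: dN; rewrite dE mem_cat mem_head orbT.
Qed.

Lemma cat_last_inj (T : eqType) (x : T) (a b c d : seq T) :
  x \notin b -> x \notin d -> a ++ x :: b = c ++ x :: d -> a = c /\ b = d.
Proof.
move=> bN dN; rewrite -(cat_rcons x c) => /(cat_cons_notin dN)[t].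
case/lastP: t => [|t y]; first by rewrite cats1 => -[/rcons_inj[-> ->]].
rewrite -rcons_cons -rcons_cat => -[/rcons_inj[_ <-]] bE.
by move: bN; rewrite bE mem_cat mem_rcons mem_head.
Qed.

(** The exhibited [HH] must lie in [q], which makes [t] a prefix of [q]. *)
Lemma nonneg_from_before_last q b t r : nonneg_from 0 q -> HH \notin b ->
  q ++ D :: b = t ++ HH :: r -> nonneg_from 0 t.
Proof.
move=> nq bN; rewrite -cat_rcons => /esym /(cat_cons_notin bN)[s].
case/lastP: s => [|s y]; first by rewrite cats1 => -[/rcons_inj[]].
rewrite -rcons_cons -rcons_cat => -[/rcons_inj[qE _] _].
by move: nq; rewrite qE nonneg_from_cat => /andP[].
Qed.

(** In both factorizations the exhibited [D] is the first step to go below the starting level. *)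
Lemma excursion_inj q q' b b' :
    nonneg_from 0 q -> height q = 0 -> nonneg_from 0 q' -> height q' = 0 ->
  q ++ D :: b = q' ++ D :: b' -> q = q' /\ b = b'.
Proof.
move=> nq hq nq' hq' /cat_eq_cat[[[|x t] [qE]]|[[|x t] [qE]]].
- by rewrite qE cats0 => -[->].
- case=> xD _; move: nq'; rewrite qE nonneg_from_cat hq -xD.
  by move=> /and3P[_ _ /nonneg_from_ge0].
- by rewrite qE cats0 => -[->].
- case=> xD _; move: nq; rewrite qE nonneg_from_cat hq' -xD.
  by move=> /and3P[_ _ /nonneg_from_ge0].
Qed.

(** The slid step, at even height, differs from the last horizontal step, at odd height. Lying
    before it, it would still be open there, whereas [a] closes all its even horizontal steps. *)
Lemma flattening_sliding a b a' q b' :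
  flattening a b -> sliding a' q b' -> a ++ HH :: b <> a' ++ HH :: q ++ D :: b'.
Proof.
move=> [_ bN cl od] [[_ _ bN'] _ ev nq _] /esym.
rewrite -(cat_rcons HH a) => /(cat_cons_notin bN)[t].
case/lastP: t => [|t y].
  by rewrite cats1 => -[/rcons_inj[aE]]; move: od; rewrite aE ev.
rewrite -rcons_cons -rcons_cat => -[/rcons_inj[aE <-]].
rewrite cat_rcons => /(nonneg_from_before_last nq bN') nt.
by move: cl; rewrite aE closed_in_cat /= cats0 add0r ev nt andbF.
Qed.

(** If one exhibited [HH] came before the other, it would be open in the prefix preceding the other,
    which is required to be closed. *)
Lemma sliding_inj a q b a' q' b' : sliding a q b -> sliding a' q' b' ->
  a ++ HH :: q ++ D :: b = a' ++ HH :: q' ++ D :: b' ->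
  [/\ a = a', q = q' & b = b'].
Proof.
move=> [[_ _ bN] cl ev nq hq] [[_ _ bN'] cl' ev' nq' hq'].
move=> /cat_eq_cat[[[|x t] [aE]]|[[|x t] [aE]]].
- by case=> /(excursion_inj nq hq nq' hq')[-> ->]; rewrite aE cats0.
- case=> xE /(nonneg_from_before_last nq bN) nt.
  by move: cl'; rewrite aE -xE closed_in_cat /= cats0 add0r ev nt andbF.
- by case=> /(excursion_inj nq' hq' nq hq)[-> ->]; rewrite aE cats0.
- case=> xE /(nonneg_from_before_last nq' bN') nt.
  by move: cl; rewrite aE -xE closed_in_cat /= cats0 add0r ev' nt andbF.
Qed.

(** * Injectivity, step counts and surjectivity of [e] *)

Lemma e_flattening a b : flattening a b ->
  e (a ++ U :: Dspec :: b) = a ++ HH :: b.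
Proof. by move=> [aN _ _ _]; apply: e_flatten. Qed.

Lemma e_sliding a q b : sliding a q b ->
  e (a ++ U :: q ++ D :: Dspec :: b) = a ++ HH :: q ++ D :: b.
Proof. by move=> [[aN qN _] _ _ nq hq]; apply: e_slide. Qed.

Lemma e_inj p p' : hybrid p -> hybrid p' -> Dspec \in p -> Dspec \in p' ->
  e p = e p' -> p = p'.
Proof.
move=> hp hp' dp dp'.
have [[a [b [-> f]]]|[a [q [b [-> f]]]]] := hybrid_special hp dp;
have [[a' [b' [-> f']]]|[a' [q' [b' [-> f']]]]] := hybrid_special hp' dp'.
- rewrite !e_flattening //.
  by case: f f' => _ bN _ _ [_ bN' _ _] /(cat_last_inj bN bN')[-> ->].
- by rewrite e_flattening // e_sliding // => /(flattening_sliding f f').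
- by rewrite e_sliding // e_flattening // => /esym/(flattening_sliding f' f).
- by rewrite !e_sliding // => /(sliding_inj f f')[-> -> ->].
Qed.

Lemma path_length_cat p q :
  path_length (p ++ q) = (path_length p + path_length q)%N.
Proof. by rewrite /path_length map_cat sumn_cat. Qed.

Lemma e_special p : hybrid p -> Dspec \in p ->
  [/\ hybrid (e p), path_length (e p) = path_length p,
      num_special p = (num_special (e p)).+1 &
      num_horizontal (e p) = (num_horizontal p).+1].
Proof.
move=> hp /(hybrid_special hp)[[a [b [pE f]]]|[a [q [b [pE f]]]]]; move: hp.
  rewrite pE e_flattening // (hybrid_flattening f) => hp; split=> //.
  - by rewrite !path_length_cat /path_length /=; lia.
  - by rewrite /num_special !count_cat /=; lia.
  - by rewrite /num_horizontal !count_cat /=; lia.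
rewrite pE e_sliding // (hybrid_sliding f) => hp; split=> //.
- by rewrite !(path_length_cat, =^~ cat_cons) /path_length /=; lia.
- by rewrite /num_special !(count_cat, =^~ cat_cons) /=; lia.
- by rewrite /num_horizontal !(count_cat, =^~ cat_cons) /=; lia.
Qed.

Lemma hybrid_e_surj p : hybrid p -> HH \in p ->
  exists p', [/\ hybrid p', Dspec \in p' & e p' = p].
Proof.
move=> hp /(hybrid_horizontal hp)[[a [b [pE f]]]|[a [q [b [pE f]]]]].
  exists (a ++ U :: Dspec :: b); split; last by rewrite e_flattening.
    by apply/(hybrid_flattening f); rewrite -pE.
  by rewrite !(mem_cat, in_cons) eqxx !orbT.
exists (a ++ U :: q ++ D :: Dspec :: b); split; last by rewrite e_sliding.
  by apply/(hybrid_sliding f); rewrite -pE.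
by rewrite !(mem_cat, in_cons) eqxx !orbT.
Qed.

(** * Identification with the inductively generated paths *)

Lemma even_special_dyckP p : even_special_dyck p <-> hybrid p /\ HH \notin p.
Proof.
split=> [[[h0 np] pN sp]|[[np h0 sp _] pN]].
  split=> //; split=> //; last by exists [::], p.
    by apply/nonneg_fromP => q r; rewrite add0r; apply: np.
  by apply/specials_evenP => q r; rewrite add0r; apply: sp.
split=> //.
  by split=> // q r pE; rewrite -[height q]add0r; apply: (nonneg_fromP _ _ np) pE.
by move=> q r pE; rewrite -[height q]add0r; apply: (specials_evenP _ _ sp) pE.
Qed.

Lemma little_hybridP p : little_hybrid p <-> hybrid p.
Proof.
split.
  elim=> {p} [p /even_special_dyckP[]//|p _ hp].
  have [dp|dp] := boolP (Dspec \in p); last by rewrite e_id.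
  by have [] := e_special hp dp.
(* Each preimage under [e] has one horizontal step fewer, until an even-special Dyck path is
   reached. *)
have [n] := ubnP (num_horizontal p); elim: n p => // n IH p ltpn hp.
have [hhp|hhp] := boolP (HH \in p); last first.
  by apply: LittleHybridBase; apply/even_special_dyckP.
have [p' [hp' dp' pE]] := hybrid_e_surj hp hhp.
have [_ _ _ hE] := e_special hp' dp'.
rewrite -pE; apply/LittleHybridStep/IH => //.
by move: ltpn; rewrite -pE hE ltnS.
Qed.

Lemma little_schroder_flat p :
  little_schroder p /\ HH \notin p <-> even_special_dyck p /\ Dspec \notin p.
Proof.
split=> [[[lp dN _] hN]|[[lp hN _] dN]]; split=> //; split=> // q r pE.
  by move: dN; rewrite pE mem_cat mem_head orbT.
by move: hN; rewrite pE mem_cat mem_head orbT.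
Qed.

End Paths.
Unset Implicit Arguments.

Theorem corollary3 (n : nat) :
  set_bij
    [set p | [/\ even_special_dyck p, path_length p = n & num_special p = 0]]
    [set p | [/\ little_schroder p, path_length p = n & num_horizontal p = 0]]
    e
  /\
  forall j k : nat, (1 <= j)%N ->
    set_bij
      [set p | [/\ little_hybrid p, path_length p = n,
                   num_special p = j & num_horizontal p = k]]
      [set p | [/\ little_hybrid p, path_length p = n,
                   num_special p = (j - 1)%N & num_horizontal p = (k + 1)%N]]
      e.
Proof.
split.
  (* Both sets consist of the Dyck paths with ordinary downsteps only, and [e] fixes each of
     them. *)
  have d0 p : num_special p = 0 -> Dspec \notin p.
    by move=> p0; apply/count_memPn.
  split=> [p /= [ep pn /d0 dN]|p p' /set_mem[_ _ /d0 dN] /set_mem[_ _ /d0 dN']|].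
  - have [|sp hN] := (little_schroder_flat p).2; first by [].
    by rewrite e_id //; split=> //; apply/count_memPn.
  - by rewrite !e_id.
  - move=> p /= [sp pn /count_memPn hN].
    have [|ep dN] := (little_schroder_flat p).1; first by [].
    by exists p; [split=> //; apply/count_memPn|rewrite e_id].
move=> j k j0.
have ds p : num_special p = j -> Dspec \in p.
  by move=> pj; rewrite -has_pred1 has_count -/(num_special p) pj.
split=> [p /= [/little_hybridP hp pn pj pk]||p /= [/little_hybridP hp pn pj pk]].
- have [he le se ze] := e_special hp (ds p pj).
  split; [exact/little_hybridP|by rewrite le|by rewrite -pj se subn1|].
  by rewrite ze pk addn1.
- move=> p p' /set_mem[/little_hybridP hp _ /ds pj _].
  by move=> /set_mem[/little_hybridP hp' _ /ds pj' _]; apply: e_inj.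
(* There is a horizontal step to undo because [k + 1] is positive. *)
- have [|p' [hp' dp' pE]] := hybrid_e_surj hp.
    by rewrite -has_pred1 has_count -/(num_horizontal p) pk addn1.
  have [_ le se ze] := e_special hp' dp'.
  exists p' => //; split; first exact/little_hybridP.
  + by rewrite -le pE.
  + by rewrite se pE pj subn1 prednK.
  + by apply/eqP; rewrite -eqSS -ze pE pk addn1.
Qed.
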